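(* Let $\nu\ge4$ be even, $a>0$, $b\ne0$, and put $$V_\eta(t)=at^\nu+b\eta t,\qquad\mathcal C_\nu^{\mathrm{tilt}}(\rho,\eta)=\int_{\mathbb R}(\rho-V_\eta(t))_+\,dt .$$ For every $\eta\ne0$, $V_\eta$ has a unique global minimum at $$t_\eta=-\operatorname{sgn}(b\eta)\left(\frac{|b\eta|}{a\nu}\right)^{1/(\nu-1)}.$$ Its threshold and curvature are $$\tau_\nu(\eta)=-(\nu-1)a\left(\frac{|b\eta|}{a\nu}\right)^{\nu/(\nu-1)},\qquad\kappa_{\mathrm{eff}}(\eta)=a\nu(\nu-1)\left(\frac{|b\eta|}{a\nu}\right)^{(\nu-2)/(\nu-1)}.$$ The cap $\mathcal C_\nu^{\mathrm{tilt}}(\rho,\eta)$ vanishes for $\rho\le\tau_\nu(\eta)$. For each fixed $\eta\ne0$, as $\delta=\rho-\tau_\nu(\eta)\downarrow0$, $$\mathcal C_\nu^{\mathrm{tilt}}(\tau_\nu(\eta)+\delta,\eta)=\frac{4\sqrt2}{3\sqrt{\kappa_{\mathrm{eff}}(\eta)}}\,\delta^{3/2}+O_\eta(\delta^2).$$ Moreover, for $r>0$, $$\mathcal C_\nu^{\mathrm{tilt}}(r^\nu\rho,r^{\nu-1}\eta)=r^{\nu+1}\mathcal C_\nu^{\mathrm{tilt}}(\rho,\eta).$$ Thus the crossover scales are $$|t|\asymp|\eta|^{1/(\nu-1)},\qquad|\rho|\asymp|\eta|^{\nu/(\nu-1)}.$$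
   Context: Here $x_+=\max\{x,0\}$; $t\in\mathbb R$ is the argument of the potential $V_\eta$, $\rho\in\mathbb R$ is the level, and $\eta\in\mathbb R$ is the tilt parameter. The threshold is the minimum value $V_\eta(t_\eta)$ and the curvature is $V_\eta''(t_\eta)$. $O_\eta$ denotes a bound whose constant may depend on $\eta$. The symbol $\asymp$ means comparable up to positive constant factors. *)

(* Defs.v *)
From HB Require Import structures.
From mathcomp Require Import all_boot all_order all_algebra.
From mathcomp Require Import all_classical all_reals all_analysis.
Set Implicit Arguments.
Unset Strict Implicit.
Unset Printing Implicit Defensive.
Import Order.TTheory GRing.Theory Num.Theory.
Import numFieldNormedType.Exports.
Local Open Scope classical_set_scope.
Local Open Scope ring_scope.

Section Tilt.
Context {R : realType}.
Implicit Types (nu : nat) (a b eta rho t : R).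

Definition tilt_potential nu a b eta t : R := a * t ^+ nu + b * eta * t.

Definition tilt_cap_integrand nu a b rho eta t : R :=
  Num.max (rho - tilt_potential nu a b eta t) 0.

(* [Rintegral] is 0 on non-integrable integrands; the main statement also
   asserts integrability, so this default value never occurs there. *)
Definition tilt_cap nu a b rho eta : R :=
  \int[@lebesgue_measure R]_t tilt_cap_integrand nu a b rho eta t.

Definition is_global_min (f : R -> R) (x : R) : Prop := forall y, f x <= f y.

Definition tilt_argmin nu a b eta : R :=
  - Num.sg (b * eta) * (`|b * eta| / (a * nu%:R)) `^ (nu%:R - 1)^-1.

Definition tilt_threshold nu a b eta : R :=
  - (nu%:R - 1) * a * (`|b * eta| / (a * nu%:R)) `^ (nu%:R / (nu%:R - 1)).

Definition tilt_curvature nu a b eta : R :=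
  a * nu%:R * (nu%:R - 1) *
    (`|b * eta| / (a * nu%:R)) `^ ((nu%:R - 2) / (nu%:R - 1)).

Definition scale_t nu eta : R := `|eta| `^ (nu%:R - 1)^-1.

Definition scale_rho nu eta : R := `|eta| `^ (nu%:R / (nu%:R - 1)).

(* |f| and |g| are comparable, with constants uniform over all nonzero tilts;
   in the main statement the constants may depend on nu, a and b. *)
Definition comparable_tilt (f g : R -> R) : Prop :=
  exists c C : R, [/\ 0 < c, 0 < C &
    forall eta, eta != 0 -> c * `|g eta| <= `|f eta| <= C * `|g eta|].

(* The positions T eta and levels P eta lie in the crossover regime when none
   of the three terms of rho - a t^nu - b eta t is negligible at rho = P eta,
   t = T eta. The position t = 0, where both terms of the potential vanish,
   is excluded. *)
Definition crossover nu a b (T P : R -> R) : Prop :=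
  [/\ forall eta, eta != 0 -> T eta != 0,
      comparable_tilt (fun eta => a * T eta ^+ nu) (fun eta => b * eta * T eta)
    & comparable_tilt P (fun eta => a * T eta ^+ nu)].

End Tilt.

(* Main.v *)
Require Import Defs.
From HB Require Import structures.
From mathcomp Require Import all_boot all_order all_algebra.
From mathcomp Require Import all_classical all_reals all_analysis.
From mathcomp Require Import ring lra.
Set Implicit Arguments.
Unset Strict Implicit.
Unset Printing Implicit Defensive.
Import Order.TTheory GRing.Theory Num.Theory.
Import numFieldNormedType.Exports.
Local Open Scope classical_set_scope.
Local Open Scope ring_scope.

(** The tilted potential is a strictly convex even power plus a linear term, so
    everything about its bottom follows from one inequality: Bernoulli's
    inequality for the square of the variable shows that an even power exceeds
    its tangent line at [t0] by at least a multiple of [(t - t0) ^ 2]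
    ([even_power_above_parabola]). At the critical point [t0] the tangent of
    the potential is horizontal, so this one bound yields the minimum, its
    uniqueness, and a quadratic lower bound valid on the whole line.

    That lower bound also localizes the cap: at height [delta] above the
    threshold the integrand lives within distance [h = O(sqrt delta)] of [t0].
    There the potential differs from its osculating parabola by [O(h ^ 3)], so
    replacing it by the parabola costs [O(h ^ 4) = O(delta ^ 2)]
    ([cap_asymptotics]), and the cap of a parabola is an explicit integral
    ([parabola_cap]).

    The scaling law is the substitution [t -> r t]. Taking for [r] the root
    [S = |eta| ^ (1 / (nu - 1))] reduces every tilt to a tilt of modulus one.
    For the crossover scales, dividing [a T ^ nu] and [b eta T] by [T] turns
    their comparability into that of [T ^ (nu - 1)] with
    [|eta| = S ^ (nu - 1)], hence of [T] with [S]; the level is then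
    comparable to [S ^ nu]. *)

(** * Even powers and their tangents *)

Section Powers.
Context {R : realType}.
Implicit Types x s t y : R.

(** Bernoulli's inequality in homogeneous form. Multiplying the bound for one
    exponent by [y] gives the bound for the next with the nonnegative surplus
    [(k + 1) y0 ^ k (y - y0) ^ 2]. *)
Lemma bernoulli_tangent y0 y k : 0 <= y0 -> 0 <= y ->
  y0 ^+ k.+1 + k.+1%:R * y0 ^+ k * (y - y0) <= y ^+ k.+1.
Proof.
move=> y0_ge0 y_ge0; elim: k => [|k IH].
  by rewrite !expr1 expr0 !mul1r addrC subrK.
rewrite [leRHS]exprS; apply: le_trans (ler_wpM2l y_ge0 IH).
have sq : 0 <= k.+1%:R * y0 ^+ k * (y - y0) ^+ 2.
  by rewrite mulr_ge0 ?sqr_ge0// mulr_ge0 ?exprn_ge0.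
rewrite -subr_ge0; apply: le_trans sq _; rewrite le_eqVlt; apply/orP; left.
by apply/eqP; rewrite !exprS [k.+2%:R]mulrSr; ring.
Qed.

(** Writing [t ^ n = (t ^ 2) ^ (n / 2)] and applying Bernoulli to the base
    [t ^ 2] produces [t ^ 2 - t0 ^ 2 = 2 t0 (t - t0) + (t - t0) ^ 2]: the first
    term is the tangent of [t ^ n], the second a genuine quadratic gain. *)
Lemma even_power_above_parabola t0 t n : ~~ odd n -> (2 <= n)%N ->
  t0 ^+ n + n%:R * t0 ^+ n.-1 * (t - t0)
    + n%:R / 2 * t0 ^+ n.-2 * (t - t0) ^+ 2 <= t ^+ n.
Proof.
move=> /even_halfK <-; case: (n./2) => [//|k] _.
have /= := bernoulli_tangent k (sqr_ge0 t0) (sqr_ge0 t).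
rewrite doubleS /= -!exprM !mul2n doubleS => /(le_trans _); apply.
rewrite le_eqVlt; apply/orP; left; apply/eqP.
have -> : k.*2.+2%:R = 2 * k.+1%:R :> R by rewrite -doubleS -mul2n natrM.
by rewrite !exprS; field.
Qed.

(** Multiplying the expansion for one exponent by [x + s] multiplies its
    remainder by [x + s] and adds one cubic term, so the remainder constants
    can be chosen by induction. *)
Lemma cubic_taylor x n : (2 <= n)%N ->
  exists2 M, 0 <= M & forall s, `|s| <= 1 ->
    `|(x + s) ^+ n - (x ^+ n + n%:R * x ^+ n.-1 * s
        + n%:R * (n%:R - 1) / 2 * x ^+ n.-2 * s ^+ 2)| <= M * `|s| ^+ 3.
Proof.
case: n => [|[|m]] // _ /=; elim: m => [|m [M M_ge0 IH]].
  exists 0 => // s _; rewrite mul0r normr_le0 expr0 expr1.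
  by apply/eqP; field.
pose C := `|m.+2%:R * (m.+2%:R - 1) / 2 * x ^+ m|.
exists ((`|x| + 1) * M + C) => [|s s_le1].
  by rewrite addr_ge0 ?normr_ge0// mulr_ge0// addr_ge0.
have := IH s s_le1; set e := (x + s) ^+ m.+2 - _ => e_le.
have -> : (x + s) ^+ m.+3 - (x ^+ m.+3 + m.+3%:R * x ^+ m.+2 * s
        + m.+3%:R * (m.+3%:R - 1) / 2 * x ^+ m.+1 * s ^+ 2)
   = (x + s) * e + m.+2%:R * (m.+2%:R - 1) / 2 * x ^+ m * s ^+ 3.
  by rewrite /e [m.+3%:R]mulrSr !exprS; field.
apply: le_trans (ler_normD _ _) _.
rewrite [`|_ * e|]normrM [`|_ * s ^+ 3|]normrM normrX -/C [(_ + C) * _]mulrDl.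
rewrite lerD// -mulrA ler_pM//.
by apply: le_trans (ler_normD _ _) _; rewrite lerD2l.
Qed.

End Powers.

(** * Integrals over the line *)

Section Integrals.
Context {R : realType}.
Notation mu := (@lebesgue_measure R).

Lemma integrable_compact_support (f : R -> R) u v :
  continuous f -> (forall x, ~~ (u <= x <= v) -> f x = 0) ->
  mu.-integrable setT (EFin \o f).
Proof.
move=> cf f0.
have -> : EFin \o f = (EFin \o f) \_ `[u, v].
  apply/funext => x; rewrite patchE; case: ifPn => //= xuv.
  by rewrite f0//; move: xuv; rewrite mem_setE in_itv.
apply: (integrable_mkcond _ _).1 => //.
apply: (@continuous_compact_integrable R f).
  exact: segment_compact.
by apply: continuous_subspaceT => x; exact: cf.
Qed.

Lemma Rintegral_compact_support (f : R -> R) u v :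
  (forall x, ~~ (u <= x <= v) -> f x = 0) ->
  \int[mu]_x f x = \int[mu]_(x in `[u, v]) f x.
Proof.
move=> f0; rewrite [RHS]Rintegral_mkcond; apply: eq_Rintegral => x _.
rewrite patchE; case: ifPn => // xuv.
by rewrite f0//; move: xuv; rewrite mem_setE in_itv.
Qed.

Lemma Rintegral_scale (f : R -> R) (r : R) : 0 < r ->
  continuous f -> (forall x, 0 <= f x) ->
  \int[mu]_x f x = \int[mu]_x (r * f (r * x)).
Proof.
move=> r_gt0 cf f_ge0; rewrite /Rintegral; congr fine.
have D (x : R) : is_derive x (1 : R) ( *%R r) r.
  by apply: is_derive_eq; rewrite /GRing.scale/= mulr1.
have dE : derive1 ( *%R r : R -> R) = cst r :> (R -> R).
  by apply/funext => x; rewrite derive1E derive_val.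
rewrite (@increasing_ge0_integration_by_substitutionT _ ( *%R r))//.
- by apply: eq_integral => x _ /=; rewrite fctE dE mulrC.
- by move=> x y; rewrite ltr_pM2l.
- by rewrite dE => x; exact: cvg_cst.
- by rewrite dE; exact: is_cvg_cst.
- by rewrite dE; exact: is_cvg_cst.
- exact: gt0_cvgMrNy.
- exact: gt0_cvgMry.
Qed.

Lemma continuous_parabola (k t0 : R) :
  continuous (fun t => k * (t - t0) ^+ 2).
Proof.
move=> t; apply/differentiable_continuous/derivable1_diffP.
exact: ex_derive.
Qed.

(** The integrand is positive exactly within [h = sqrt (2 delta / kappa)] of
    [t0], where a primitive gives the value [4 / 3 * delta * h]. *)
Lemma parabola_cap (kappa delta t0 : R) : 0 < kappa -> 0 < delta ->
  \int[mu]_t Num.max (delta - kappa / 2 * (t - t0) ^+ 2) 0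
    = 4 * Num.sqrt 2 / (3 * Num.sqrt kappa) * delta `^ (3 / 2).
Proof.
move=> k_gt0 d_gt0.
pose h := Num.sqrt (2 * delta / kappa).
have h_gt0 : 0 < h by rewrite sqrtr_gt0 divr_gt0// mulr_gt0.
have h2 : h ^+ 2 = 2 * delta / kappa.
  by rewrite sqr_sqrtr// ltW// divr_gt0// mulr_gt0.
have kh2 : kappa / 2 * h ^+ 2 = delta by rewrite h2; field; lra.
rewrite (@Rintegral_compact_support _ (t0 - h) (t0 + h)); last first.
  move=> t tout; apply/max_idPr.
  suff h_le : h ^+ 2 <= (t - t0) ^+ 2.
    by rewrite subr_le0 -[leLHS]kh2 ler_pM2l// divr_gt0.
  rewrite -[(t - t0) ^+ 2]real_normK ?num_real//
    ler_pXn2r ?nnegrE ?(ltW h_gt0)//.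
  by apply: ltW; rewrite ltNge; apply: contra tout; rewrite ler_distl.
transitivity (\int[mu]_(t in `[t0 - h, t0 + h])
    (delta - kappa / 2 * (t - t0) ^+ 2)).
  apply: eq_Rintegral => t; rewrite mem_setE in_itv/= -ler_distl => tin.
  apply/max_idPl; rewrite subr_ge0 -kh2 ler_pM2l ?divr_gt0//.
  by rewrite -[(t - t0) ^+ 2]real_normK ?num_real//
    ler_pXn2r ?nnegrE ?(ltW h_gt0).
pose F t := delta * (t - t0) - kappa / 6 * (t - t0) ^+ 3.
have D (t : R) : is_derive t (1 : R) F (delta - kappa / 2 * (t - t0) ^+ 2).
  by rewrite /F; apply: is_derive_eq; rewrite /GRing.scale/=; field.
have cF : continuous F.
  by move=> t; apply/differentiable_continuous/derivable1_diffP.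
rewrite /Rintegral (@continuous_FTC2 _ _ F) //=; last first.
- by move=> t _; rewrite derive1E derive_val.
- split => [t _ //||].
  + exact: cvg_at_right_filter (cF _).
  + exact: cvg_at_left_filter (cF _).
- apply: continuous_subspaceT => t.
  apply: cvgB; first exact: cvg_cst.
  exact: continuous_parabola.
- by lra.
have -> : F (t0 + h) - F (t0 - h) = 4 / 3 * delta * h.
  rewrite /F; transitivity (2 * delta * h - 2 / 3 * h * (kappa / 2 * h ^+ 2)).
    by field.
  by rewrite kh2; field.
have -> : delta `^ (3 / 2) = delta * Num.sqrt delta.
  rewrite -(powR12_sqrt (ltW d_gt0)) -[X in _ = X * _](powRr1 (ltW d_gt0)).
  rewrite -powRD; first by congr (_ `^ _); field.
  by rewrite (gt_eqF d_gt0) implybT.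
rewrite /h !sqrtrM ?sqrtrV ?mulr_ge0 ?ltW//.
by field; rewrite gt_eqF// sqrtr_gt0.
Qed.

Lemma max0B_lipschitz (d x y : R) :
  `|Num.max (d - x) 0 - Num.max (d - y) 0| <= `|x - y|.
Proof.
have := ler_norm (y - x); rewrite distrC => yx; have xy := ler_norm (x - y).
rewrite ler_norml; apply/andP; rewrite /Order.max.
by case: ltP => ?; case: ltP => ?; split; lra.
Qed.

(** With [c' = min c (kappa / 2)], both [W] and its osculating parabola
    dominate [c' (t - t0) ^ 2], so both caps are supported within
    [h = sqrt (delta / c')] of [t0]. Taking positive parts is 1-Lipschitz, so
    the caps differ by at most
    [2 h * (M * h ^ 3) = 2 M / c' ^ 2 * delta ^ 2]. *)
Lemma cap_asymptotics (W : R -> R) (kappa c M t0 : R) :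
  continuous W -> 0 < kappa -> 0 < c -> 0 <= M ->
  (forall t, c * (t - t0) ^+ 2 <= W t) ->
  (forall t, `|t - t0| <= 1 ->
    `|W t - kappa / 2 * (t - t0) ^+ 2| <= M * `|t - t0| ^+ 3) ->
  exists K, exists2 d0, 0 < d0 & forall delta, 0 < delta <= d0 ->
   `|\int[mu]_t Num.max (delta - W t) 0
      - 4 * Num.sqrt 2 / (3 * Num.sqrt kappa) * delta `^ (3 / 2)|
    <= K * delta ^+ 2.
Proof.
move=> cW k_gt0 c_gt0 M_ge0 gap tay.
pose c' := Num.min c (kappa / 2).
have c'_gt0 : 0 < c' by rewrite lt_min c_gt0 divr_gt0.
(* For delta <= c' the support radius h is at most 1, so the cubic bound
   applies on the whole support. *)
exists (2 * M / c' ^+ 2); exists c' => // delta /andP[d_gt0 d_le].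
rewrite -(parabola_cap t0)//.
pose h := Num.sqrt (delta / c').
have h_gt0 : 0 < h by rewrite sqrtr_gt0 divr_gt0.
have h2 : h ^+ 2 = delta / c' by rewrite sqr_sqrtr// ltW// divr_gt0.
have h_le1 : h <= 1.
  by rewrite -sqrtr1 ler_wsqrtr// ler_pdivrMr// mul1r.
have vanish (q : R -> R) : (forall t, c' * (t - t0) ^+ 2 <= q t) ->
    forall t, ~~ (t0 - h <= t <= t0 + h) -> Num.max (delta - q t) 0 = 0.
  move=> cq t tout; apply/max_idPr; rewrite subr_le0.
  apply: le_trans (cq t); rewrite -ler_pdivrMl// mulrC -h2.
  rewrite -[(t - t0) ^+ 2]real_normK ?num_real//
    ler_pXn2r ?nnegrE ?(ltW h_gt0)//.
  by apply: ltW; rewrite ltNge; apply: contra tout; rewrite ler_distl.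
have sqc (q : R) t : c' <= q -> c' * (t - t0) ^+ 2 <= q * (t - t0) ^+ 2.
  by move=> cq; rewrite ler_wpM2r// sqr_ge0.
have gapW t : c' * (t - t0) ^+ 2 <= W t.
  by apply: le_trans (gap t); rewrite sqc// ge_min lexx.
have gapP t : c' * (t - t0) ^+ 2 <= kappa / 2 * (t - t0) ^+ 2.
  by rewrite sqc// ge_min lexx orbT.
have cP : continuous (fun t => kappa / 2 * (t - t0) ^+ 2).
  exact: continuous_parabola.
have cmax (q : R -> R) : continuous q ->
    continuous (fun t => Num.max (delta - q t) 0).
  move=> cq t; apply: (@continuous_max _ _ (fun t => delta - q t) (cst 0)).
    by apply: cvgB; [exact: cvg_cst|exact: cq].
  exact: cvg_cst.
have intW := integrable_compact_support (cmax _ cW) (vanish _ gapW).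
have intP := integrable_compact_support (cmax _ cP) (vanish _ gapP).
rewrite -RintegralB//.
rewrite (@Rintegral_compact_support _ (t0 - h) (t0 + h)); last first.
  by move=> t tout; rewrite (vanish _ gapW)// (vanish _ gapP)// subr0.
have intD : mu.-integrable `[t0 - h, t0 + h]
   (EFin \o (fun t => Num.max (delta - W t) 0
     - Num.max (delta - kappa / 2 * (t - t0) ^+ 2) 0)).
  apply: (@integrableS _ _ _ _ setT) => //.
  exact: (integrableB measurableT intW intP).
apply: le_trans (le_normr_Rintegral _ intD) _ => //.
apply: (@le_trans _ _ (\int[mu]_(t in `[t0 - h, t0 + h]) (M * h ^+ 3))).
  apply: le_Rintegral => //.
  - exact: integrable_abse intD.
  - apply: continuous_compact_integrable; first exact: segment_compact.
    by apply: continuous_subspaceT => x; exact: cvg_cst.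
  move=> t /=; rewrite in_itv/= -ler_distl => th.
  apply: le_trans (max0B_lipschitz _ _ _) _.
  apply: le_trans (tay _ (le_trans th h_le1)) _.
  by rewrite ler_wpM2l// ler_pXn2r ?nnegrE ?(ltW h_gt0).
rewrite Rintegral_cst//= lebesgue_measure_itv/= lte_fin ifT; last by lra.
rewrite /= le_eqVlt; apply/orP; left; apply/eqP.
transitivity (2 * M * (h ^+ 2) ^+ 2); first by ring.
by rewrite h2; field; rewrite gt_eqF.
Qed.

End Integrals.

(** * Calculus of comparability *)

Section Comparable.
Context {R : realType}.
Implicit Types f g h : R -> R.

Lemma comparable_tilt_sym f g : comparable_tilt f g -> comparable_tilt g f.
Proof.
move=> [c [C [c_gt0 C_gt0 fg]]]; exists C^-1, c^-1; split; rewrite ?invr_gt0//.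
move=> eta /fg /andP[cf fC].
by rewrite ler_pdivrMl// ler_pdivlMl// cf fC.
Qed.

Lemma comparable_tilt_trans f g h :
  comparable_tilt f g -> comparable_tilt g h -> comparable_tilt f h.
Proof.
move=> [c [C [c_gt0 C_gt0 fg]]] [d [D [d_gt0 D_gt0 gh]]].
exists (c * d), (C * D); split; rewrite ?mulr_gt0// => eta eta0.
have /andP[cf fC] := fg _ eta0; have /andP[dg gD] := gh _ eta0.
rewrite -!mulrA; apply/andP; split.
  by apply: le_trans cf; rewrite ler_pM2l.
by apply: le_trans fC _; rewrite ler_pM2l.
Qed.

Lemma comparable_tilt_proportional k f g : 0 < k ->
  (forall eta, eta != 0 -> `|f eta| = k * `|g eta|) -> comparable_tilt f g.
Proof.
by move=> k_gt0 fg; exists k, k; split=> // eta /fg ->; rewrite lexx.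
Qed.

Lemma comparable_tilt_mul2l h f g : (forall eta, eta != 0 -> h eta != 0) ->
  comparable_tilt (fun eta => h eta * f eta) (fun eta => h eta * g eta)
    <-> comparable_tilt f g.
Proof.
move=> h0; split=> -[c [C [c_gt0 C_gt0 fg]]]; exists c, C; split=> // eta eta0;
have := fg _ eta0; have : 0 < `|h eta| by rewrite normr_gt0 h0.
all: by move=> h_gt0; rewrite !normrM !(mulrCA _ `|h eta|) !ler_pM2l.
Qed.

Lemma comparable_tilt_exp n f g : (0 < n)%N ->
  comparable_tilt (fun eta => f eta ^+ n) (fun eta => g eta ^+ n)
    <-> comparable_tilt f g.
Proof.
move=> n_gt0; split=> -[c [C [c_gt0 C_gt0 fg]]]; last first.
  exists (c ^+ n), (C ^+ n); split=> [||eta /fg]; rewrite ?exprn_gt0//.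
  move=> /andP[cf fC]; have c_ge0 := ltW c_gt0; have C_ge0 := ltW C_gt0.
  by rewrite !normrX -!exprMn !ler_pXn2r ?cf ?fC// nnegrE// mulr_ge0.
have root (k : R) : 0 < k -> (k `^ n%:R^-1) ^+ n = k.
  move=> k_gt0; rewrite -powR_mulrn ?powR_ge0// -powRrM mulVf ?powRr1// ?ltW//.
  by rewrite pnatr_eq0 -lt0n.
exists (c `^ n%:R^-1), (C `^ n%:R^-1); split=> [||eta /fg]; rewrite ?powR_gt0//.
rewrite !normrX -{1}(root c)// -{1}(root C)// -!exprMn.
by rewrite !ler_pXn2r// nnegrE// mulr_ge0 ?powR_ge0.
Qed.

End Comparable.

(** * The tilted potential *)

Section Tilt.
Context {R : realType} (nu : nat) (a b : R).
Hypotheses (nu_ge4 : (4 <= nu)%N) (nu_even : ~~ odd nu).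
Hypotheses (a_gt0 : 0 < a) (b_neq0 : b != 0).
Implicit Types (rho eta t u : R).
Notation mu := (@lebesgue_measure R).
Notation V := (tilt_potential nu a b).

Let nuE : nu = nu.-2.+2.
Proof. by case: nu nu_ge4 => [|[|n]]. Qed.

Let nu_ge2 : (2 <= nu)%N.
Proof. exact: leq_trans nu_ge4. Qed.

Let nuP : nu.-1 = nu.-2.+1.
Proof. by rewrite {1}nuE. Qed.

Let nuR_gt0 : 0 < nu%:R :> R.
Proof. by rewrite ltr0n nuE. Qed.

Let nu1R_gt0 : 0 < nu%:R - 1 :> R.
Proof. by rewrite subr_gt0 ltr1n nuE. Qed.

Let nu1RE : nu.-1%:R = nu%:R - 1 :> R.
Proof. by rewrite nuE /= [in RHS]mulrSr addrK. Qed.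

Let nu2RE : nu.-2%:R = nu%:R - 2 :> R.
Proof. by rewrite nuE /= 2![in RHS]mulrSr; ring. Qed.

Lemma expr_norm_even n x : ~~ odd n -> `|x| ^+ n = x ^+ n :> R.
Proof.
by move=> /even_halfK <-; rewrite -mul2n !exprM real_normK ?num_real.
Qed.

Lemma is_derive_monomial_linear (k c t : R) n :
  is_derive t (1 : R) (fun t => k * t ^+ n + c * t) (k * n%:R * t ^+ n.-1 + c).
Proof.
have -> : (fun t => k * t ^+ n + c * t) = k *: (id ^+ n : R -> R) + c *: id.
  by apply/funext => x; rewrite !fctE.
have D := is_derive_id t (1 : R).
apply: is_derive_eq
  (is_deriveD (is_deriveZ k (is_deriveX n D)) (is_deriveZ c D)) _.
by rewrite /GRing.scale/= !mulr1 mulrA.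
Qed.

Lemma continuous_tilt_potential eta : continuous (V eta).
Proof.
move=> t; apply/differentiable_continuous/derivable1_diffP.
by have [] := is_derive_monomial_linear a (b * eta) t nu.
Qed.

Lemma continuous_tilt_cap_integrand rho eta :
  continuous (tilt_cap_integrand nu a b rho eta).
Proof.
move=> t; apply: (@continuous_max _ _ (fun t => rho - V eta t) (cst 0)).
  by apply: cvgB; [exact: cvg_cst|exact: continuous_tilt_potential].
exact: cvg_cst.
Qed.

(** For [|t| >= 1] the potential is at least [a t ^ 2 - |b eta| |t|], so it is
    at least [rho] as soon as moreover [a |t| >= |b eta| + |rho|]. *)
Lemma tilt_cap_integrand_support rho eta : exists B, forall t,
  ~~ (- B <= t <= B) -> tilt_cap_integrand nu a b rho eta t = 0.
Proof.
exists (1 + (`|b * eta| + `|rho|) / a) => t; rewrite -ler_norml -ltNge => tB.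
have q_ge0 : 0 <= (`|b * eta| + `|rho|) / a by rewrite divr_ge0 ?addr_ge0// ltW.
have t_ge1 : 1 <= `|t| by lra.
apply/max_idPr; rewrite subr_le0.
have at_ge : `|b * eta| + `|rho| <= a * `|t|.
  by rewrite -ler_pdivrMl// mulrC; lra.
have tnu : `|t| ^+ 2 <= t ^+ nu.
  by rewrite -(expr_norm_even _ nu_even) ler_weXn2l// (leq_trans _ nu_ge4).
have := ler_wpM2r (normr_ge0 t) at_ge.
have := ler_wpM2l (ltW a_gt0) tnu.
have := ler_norm (- (b * eta * t)); rewrite normrN normrM => lin quad big.
have rho_le := ler_norm rho.
have := ler_wpM2l (normr_ge0 rho) t_ge1.
rewrite /tilt_potential; lra.
Qed.

Lemma tilt_cap_integrable rho eta :
  mu.-integrable setT (EFin \o tilt_cap_integrand nu a b rho eta).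
Proof.
have [B B0] := tilt_cap_integrand_support rho eta.
exact: integrable_compact_support (@continuous_tilt_cap_integrand rho eta) B0.
Qed.

Lemma tilt_cap_scale r rho eta : 0 < r ->
  tilt_cap nu a b (r ^+ nu * rho) (r ^+ nu.-1 * eta)
    = r ^+ nu.+1 * tilt_cap nu a b rho eta.
Proof.
move=> r_gt0; rewrite /tilt_cap (Rintegral_scale r_gt0); first last.
- by move=> t; rewrite le_max lexx orbT.
- exact: continuous_tilt_cap_integrand.
rewrite -RintegralZl//; last exact: tilt_cap_integrable.
apply: eq_Rintegral => t _; rewrite exprS -mulrA; congr (_ * _).
rewrite /tilt_cap_integrand maxr_pMr ?exprn_ge0// ?ltW// mulr0; congr Num.max.
by rewrite /tilt_potential exprMn nuE /= !exprS; ring.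
Qed.

(** The three fractional powers in the closed formulas are the powers [nu - 1],
    [nu] and [nu - 2] of a single root, which keeps the rest polynomial. *)
Lemma root_exp_pred u : 0 <= u -> (u `^ (nu%:R - 1)^-1) ^+ nu.-1 = u.
Proof.
move=> u_ge0; rewrite -powR_mulrn ?powR_ge0// -powRrM nu1RE mulVf ?powRr1//.
by rewrite gt_eqF.
Qed.

Lemma root_exp_nu u : (u `^ (nu%:R - 1)^-1) ^+ nu = u `^ (nu%:R / (nu%:R - 1)).
Proof. by rewrite -powR_mulrn ?powR_ge0// -powRrM mulrC. Qed.

Lemma root_exp_nu2 u :
  (u `^ (nu%:R - 1)^-1) ^+ nu.-2 = u `^ ((nu%:R - 2) / (nu%:R - 1)).
Proof. by rewrite -powR_mulrn ?powR_ge0// -powRrM mulrC nu2RE. Qed.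

(** * The bottom of the potential for a nonzero tilt *)

Section NonzeroTilt.
Variable eta : R.
Hypothesis eta_neq0 : eta != 0.
Let t0 := tilt_argmin nu a b eta.
Let T := (`|b * eta| / (a * nu%:R)) `^ (nu%:R - 1)^-1.

Let be_neq0 : b * eta != 0. Proof. by rewrite mulf_neq0. Qed.

Let T_gt0 : 0 < T.
Proof. by rewrite powR_gt0// divr_gt0 ?normr_gt0// mulr_gt0. Qed.

Let norm_t0 : `|t0| = T.
Proof.
by rewrite normrM normrN normr_sg be_neq0 mul1r gtr0_norm.
Qed.

Let nu2_even : ~~ odd nu.-2.
Proof. by move: nu_even; rewrite {1}nuE /= negbK. Qed.

(** This is [V'(t0) = 0]. It eliminates the tilt [b * eta] in favour of [t0], so
    that the values below become polynomial identities in [t0]. *)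
Lemma tilt_argmin_critical : a * nu%:R * t0 ^+ nu.-1 = - (b * eta).
Proof.
have anu : a * nu%:R != 0 by rewrite mulf_neq0// gt_eqF.
have -> : t0 ^+ nu.-1 = - Num.sg (b * eta) * (`|b * eta| / (a * nu%:R)).
  rewrite nuP exprS -(expr_norm_even _ nu2_even) norm_t0.
  have <- : T ^+ nu.-1 = `|b * eta| / (a * nu%:R).
    by rewrite root_exp_pred// divr_ge0// mulr_ge0// ltW.
  by rewrite [in RHS]nuP exprS mulrA.
rewrite [in RHS](numEsg (b * eta)); field; move: anu.
by rewrite mulf_eq0 negb_or andbC.
Qed.

Lemma tilt_potential_argmin : V eta t0 = tilt_threshold nu a b eta.
Proof.
rewrite /tilt_potential /tilt_threshold -root_exp_nu -/T -norm_t0.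
rewrite expr_norm_even// -[b * eta]opprK -tilt_argmin_critical.
by rewrite nuE /= !exprS; ring.
Qed.

Lemma tilt_curvatureE :
  tilt_curvature nu a b eta = a * nu%:R * (nu%:R - 1) * t0 ^+ nu.-2.
Proof.
by rewrite /tilt_curvature -root_exp_nu2 -/T -norm_t0 expr_norm_even.
Qed.

Lemma tilt_curvature_gt0 : 0 < tilt_curvature nu a b eta.
Proof.
by rewrite /tilt_curvature -root_exp_nu2 !mulr_gt0// exprn_gt0.
Qed.

(** Since the tilt cancels the slope at [t0], what remains of the potential
    above its tangent is the quadratic gain of the even power. *)
Lemma tilt_potential_gap t :
  a * (nu%:R / 2) * T ^+ nu.-2 * (t - t0) ^+ 2
    <= V eta t - tilt_threshold nu a b eta.
Proof.
rewrite -tilt_potential_argmin /tilt_potential -[b * eta]opprK.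
rewrite -tilt_argmin_critical -norm_t0 expr_norm_even//.
have := even_power_above_parabola t0 t nu_even nu_ge2.
move=> /(ler_wpM2l (ltW a_gt0)); lra.
Qed.

Lemma tilt_argmin_unique : unique (is_global_min (V eta)) t0.
Proof.
have gap_gt0 : 0 < a * (nu%:R / 2) * T ^+ nu.-2.
  by rewrite !mulr_gt0// ?exprn_gt0// invr_gt0.
split=> [t|t tmin].
  rewrite tilt_potential_argmin -subr_ge0.
  apply: le_trans (tilt_potential_gap t).
  by rewrite mulr_ge0 ?sqr_ge0// ltW.
apply/eqP; rewrite eq_sym -subr_eq0 -sqrf_eq0 eq_le sqr_ge0 andbT.
rewrite -(ler_pM2l gap_gt0) mulr0; apply: le_trans (tilt_potential_gap t) _.
by rewrite subr_le0 -tilt_potential_argmin.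
Qed.

Lemma tilt_second_derivative :
  derive1n 2 (V eta) t0 = tilt_curvature nu a b eta.
Proof.
rewrite tilt_curvatureE derive1nS derive1n1.
have -> : derive1 (V eta) = fun t => a * nu%:R * t ^+ nu.-1 + b * eta.
  apply/funext => t; rewrite derive1E; apply: derive_val.
  exact: is_derive_monomial_linear.
rewrite derive1E; apply: derive_val; rewrite -nu1RE.
have -> : (fun t => a * nu%:R * t ^+ nu.-1 + b * eta) =
    (fun t => a * nu%:R * t ^+ nu.-1 + 0 * t) + cst (b * eta).
  by apply/funext => t; rewrite !fctE mul0r addr0.
have D := is_derive_monomial_linear (a * nu%:R) 0 t0 nu.-1.
by apply: is_derive_eq; rewrite !addr0.
Qed.

Lemma tilt_cap_below rho :
  rho <= tilt_threshold nu a b eta -> tilt_cap nu a b rho eta = 0.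
Proof.
move=> rho_le; rewrite /tilt_cap -[RHS](Rintegral_set0 mu (cst 0)).
rewrite [RHS]Rintegral_mkcond; apply: eq_Rintegral => t _.
rewrite patchE in_set0; apply/max_idPr; rewrite subr_le0.
apply: le_trans rho_le _; rewrite -tilt_potential_argmin.
exact: tilt_argmin_unique.1.
Qed.

(** The excess of the potential over its threshold meets the assumptions of
    [cap_asymptotics]: coercivity is [tilt_potential_gap], and the cubic
    contact with the parabola of curvature [V''(t0)] is [cubic_taylor]. *)
Lemma tilt_cap_asymptotics delta :
  tilt_cap nu a b (tilt_threshold nu a b eta + delta) eta
    = 4 * Num.sqrt 2 / (3 * Num.sqrt (tilt_curvature nu a b eta))
        * delta `^ (3 / 2)
      +O_(delta \near 0^'+) (delta ^+ 2).
Proof.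
pose W t := V eta t - tilt_threshold nu a b eta.
have cW : continuous W.
  by move=> t; apply: cvgB; [exact: continuous_tilt_potential|exact: cvg_cst].
have c_gt0 : 0 < a * (nu%:R / 2) * T ^+ nu.-2.
  by rewrite !mulr_gt0// ?exprn_gt0// invr_gt0.
have [M M_ge0 tay] := cubic_taylor t0 nu_ge2.
have [||K [d0 d0_gt0 capK]] :=
  cap_asymptotics cW tilt_curvature_gt0 c_gt0 (M := a * M) _ tilt_potential_gap.
- by rewrite mulr_ge0// ltW.
- move=> t /tay; rewrite addrCA subrr addr0 => tayt.
  rewrite /W -tilt_potential_argmin tilt_curvatureE /tilt_potential.
  rewrite -[b * eta]opprK -tilt_argmin_critical.
  rewrite -[leRHS]mulrA.
  rewrite -(ler_pM2l a_gt0) in tayt.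
  apply: le_trans tayt.
  rewrite -[in leRHS](gtr0_norm a_gt0) -normrM.
  rewrite le_eqVlt; apply/orP; left; apply/eqP; congr `|_|.
  by field.
pose f d := tilt_cap nu a b (tilt_threshold nu a b eta + d) eta.
pose g d := 4 * Num.sqrt 2 / (3 * Num.sqrt (tilt_curvature nu a b eta))
        * d `^ (3 / 2).
suff : f = g +O_ (0^'+) (fun d : R => d ^+ 2).
  by move=> fg; have := congr1 (fun h : R -> R => h delta) fg; exact.
apply/eqaddOP/bigO_exP; exists (`|K| + 1); first by rewrite ltr_wpDl.
have : \forall d \near 0^'+, 0 < d <= d0.
  near=> d; apply/andP; split; near: d; first exact: nbhs_right_gt.
  exact: nbhs_right_le.
apply: filterS => d d_bd; have := capK d d_bd.
have <- : f d = \int[mu]_t Num.max (d - W t) 0.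
  apply: eq_Rintegral => t _; congr Num.max; rewrite /W; ring.
move=> /le_trans; apply; rewrite [`|d ^+ 2|]ger0_norm ?sqr_ge0//.
rewrite ler_wpM2r ?sqr_ge0//; have := ler_norm K; lra.
Unshelve. all: by end_near. Qed.

End NonzeroTilt.

(** * Crossover scales *)

Lemma scale_t_gt0 eta : eta != 0 -> 0 < scale_t nu eta.
Proof. by move=> eta0; rewrite powR_gt0// normr_gt0. Qed.

Lemma scale_t_exp_pred eta : scale_t nu eta ^+ nu.-1 = `|eta|.
Proof. exact: root_exp_pred. Qed.

Lemma scale_t_exp_nu eta : scale_t nu eta ^+ nu = scale_rho nu eta.
Proof. exact: root_exp_nu. Qed.

Lemma sg_scale_t eta : eta = scale_t nu eta ^+ nu.-1 * Num.sg eta.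
Proof. by rewrite scale_t_exp_pred mulrC -numEsg. Qed.

Lemma tilt_potential_scale_t eta t :
  V eta (scale_t nu eta * t) = scale_rho nu eta * V (Num.sg eta) t.
Proof.
rewrite /tilt_potential [X in b * X * _]sg_scale_t -scale_t_exp_nu exprMn.
by rewrite nuE /= !exprS; ring.
Qed.

Lemma tilt_cap_scale_t eta rho : eta != 0 ->
  tilt_cap nu a b (scale_rho nu eta * rho) eta
    = scale_t nu eta * scale_rho nu eta * tilt_cap nu a b rho (Num.sg eta).
Proof.
move=> eta0; rewrite [X in tilt_cap nu a b _ X = _]sg_scale_t -scale_t_exp_nu.
by rewrite tilt_cap_scale ?scale_t_gt0// exprS.
Qed.

Lemma powR_tilt_ratio eta p :
  (`|b * eta| / (a * nu%:R)) `^ p = (`|b| / (a * nu%:R)) `^ p * `|eta| `^ p.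
Proof.
have ratio_ge0 : 0 <= `|b| / (a * nu%:R) by rewrite divr_ge0// mulr_ge0// ltW.
by rewrite -(powRM p ratio_ge0 (normr_ge0 eta)) normrM mulrAC.
Qed.

Lemma comparable_tilt_argmin :
  comparable_tilt (tilt_argmin nu a b) (scale_t nu).
Proof.
apply: (@comparable_tilt_proportional _
  ((`|b| / (a * nu%:R)) `^ (nu%:R - 1)^-1)).
  by rewrite powR_gt0// divr_gt0 ?normr_gt0// mulr_gt0.
move=> eta eta0; rewrite [`|scale_t _ _|]ger0_norm ?powR_ge0// /scale_t.
rewrite /tilt_argmin normrM normrN normr_sg mulf_neq0// mul1r.
by rewrite ger0_norm ?powR_ge0// powR_tilt_ratio.
Qed.

Lemma comparable_tilt_threshold :
  comparable_tilt (tilt_threshold nu a b) (scale_rho nu).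
Proof.
apply: (@comparable_tilt_proportional _ ((nu%:R - 1) * a *
    (`|b| / (a * nu%:R)) `^ (nu%:R / (nu%:R - 1)))).
  by rewrite !mulr_gt0// powR_gt0// divr_gt0 ?normr_gt0// mulr_gt0.
move=> eta eta0; rewrite [`|scale_rho _ _|]ger0_norm ?powR_ge0// /scale_rho.
rewrite /tilt_threshold !mulNr normrN ger0_norm; last first.
  by rewrite !mulr_ge0 ?powR_ge0// ltW.
by rewrite powR_tilt_ratio mulrA.
Qed.

(** Cancelling the nonvanishing factor [T eta] and taking a root of order
    [nu - 1] turns the balance of the two terms of the potential into
    [T ~ S]; raising back to the power [nu] fixes the size of the level. *)
Lemma crossoverP (T P : R -> R) : crossover nu a b T P <->
  comparable_tilt T (scale_t nu) /\ comparable_tilt P (scale_rho nu).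
Proof.
pose S : R -> R := scale_t nu.
have S_neq0 eta : eta != 0 -> S eta != 0.
  by move=> eta0; rewrite gt_eqF// scale_t_gt0.
have balance : (forall eta, eta != 0 -> T eta != 0) ->
    comparable_tilt (fun eta => a * T eta ^+ nu) (fun eta => b * eta * T eta)
    <-> comparable_tilt T S.
  move=> T_neq0.
  have expT := @comparable_tilt_exp _ nu.-1 T S; rewrite nuP in expT.
  apply: iff_trans (expT isT); rewrite -nuP {expT}.
  apply: iff_trans (comparable_tilt_mul2l _ _ T_neq0).
  have lhs : comparable_tilt (fun eta => a * T eta ^+ nu)
                             (fun eta => T eta * T eta ^+ nu.-1).
    apply: (comparable_tilt_proportional a_gt0) => eta _.
    by rewrite -exprS {1}nuE -nuP normrM gtr0_norm.
  have rhs : comparable_tilt (fun eta => b * eta * T eta)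
                             (fun eta => T eta * S eta ^+ nu.-1).
    apply: (@comparable_tilt_proportional _ `|b|); first by rewrite normr_gt0.
    by move=> eta _; rewrite /S scale_t_exp_pred !normrM normr_id; ring.
  split=> [TT|TT].
    apply: comparable_tilt_trans (comparable_tilt_sym lhs) _.
    exact: comparable_tilt_trans TT rhs.
  apply: comparable_tilt_trans lhs _.
  exact: comparable_tilt_trans TT (comparable_tilt_sym rhs).
have level : comparable_tilt T S ->
    comparable_tilt (fun eta => a * T eta ^+ nu) (scale_rho nu).
  move=> TS; apply: (@comparable_tilt_trans _ _ (fun eta => T eta ^+ nu)).
    apply: (comparable_tilt_proportional a_gt0) => eta _.
    by rewrite normrM gtr0_norm.
  have -> : scale_rho nu = fun eta => S eta ^+ nu :> R.
    by apply/funext => eta; rewrite scale_t_exp_nu.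
  by apply/comparable_tilt_exp => //; rewrite nuE.
split=> [[T_neq0 /(balance T_neq0) TS PT]|[TS PS]].
  by split=> //; exact: comparable_tilt_trans PT (level TS).
have T_neq0 eta : eta != 0 -> T eta != 0.
  have [c [C [c_gt0 _ TSb]]] := TS => eta0; have /andP[cT _] := TSb _ eta0.
  rewrite -normr_gt0; apply: lt_le_trans cT.
  by rewrite mulr_gt0// normr_gt0 S_neq0.
split=> //; first exact/balance.
exact: comparable_tilt_trans PS (comparable_tilt_sym (level TS)).
Qed.

End Tilt.

Theorem proposition6p6 (R : realType) (nu : nat) (a b : R)
    (nu_ge4 : (4 <= nu)%N) (nu_even : ~~ odd nu) (a_gt0 : 0 < a)
    (b_neq0 : b != 0) :
  (forall rho eta : R,
     (@lebesgue_measure R).-integrable setT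
       (EFin \o tilt_cap_integrand nu a b rho eta)) /\
  (forall eta : R, eta != 0 ->
    [/\ unique (is_global_min (tilt_potential nu a b eta))
               (tilt_argmin nu a b eta),
        tilt_potential nu a b eta (tilt_argmin nu a b eta)
          = tilt_threshold nu a b eta,
        derive1n 2 (tilt_potential nu a b eta) (tilt_argmin nu a b eta)
          = tilt_curvature nu a b eta,
        forall rho : R, rho <= tilt_threshold nu a b eta ->
          tilt_cap nu a b rho eta = 0
      & forall delta : R,
          tilt_cap nu a b (tilt_threshold nu a b eta + delta) eta
            = 4 * Num.sqrt 2 / (3 * Num.sqrt (tilt_curvature nu a b eta))
                * delta `^ (3 / 2)
              +O_(delta \near 0^'+) (delta ^+ 2)]) /\
  (forall r rho eta : R, 0 < r ->
     tilt_cap nu a b (r ^+ nu * rho) (r ^+ nu.-1 * eta)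
       = r ^+ nu.+1 * tilt_cap nu a b rho eta) /\
  [/\ forall eta t : R, eta != 0 ->
        tilt_potential nu a b eta (scale_t nu eta * t)
          = scale_rho nu eta * tilt_potential nu a b (Num.sg eta) t,
      forall eta rho : R, eta != 0 ->
        tilt_cap nu a b (scale_rho nu eta * rho) eta
          = scale_t nu eta * scale_rho nu eta
            * tilt_cap nu a b rho (Num.sg eta),
      comparable_tilt (tilt_argmin nu a b) (scale_t nu),
      comparable_tilt (tilt_threshold nu a b) (scale_rho nu)
    & forall T P : R -> R,
        crossover nu a b T P <->
        comparable_tilt T (scale_t nu) /\ comparable_tilt P (scale_rho nu)].
Proof.
split; first by move=> rho eta; exact: tilt_cap_integrable.
split=> [eta eta0|].
  split.
  - exact: tilt_argmin_unique.
  - exact: tilt_potential_argmin.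
  - exact: tilt_second_derivative.
  - by move=> rho; exact: tilt_cap_below.
  - by move=> delta; exact: tilt_cap_asymptotics.
split=> [r rho eta|]; first exact: tilt_cap_scale.
split.
- by move=> eta t _; exact: tilt_potential_scale_t.
- by move=> eta rho; exact: tilt_cap_scale_t.
- exact: comparable_tilt_argmin.
- exact: comparable_tilt_threshold.
- by move=> T P; exact: crossoverP.
Qed.
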